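(* Let $(\Omega,\mathcal F,\mathbf P)$, $A$, $X$, $\theta$, $\Theta=\mathbb R_{\ge 0}^n$, $G=\mathbb R_{>0}^d$, the action of $G$ on $\mathbb Z_{\ge 0}^d\times\Theta$ and the $\sigma$-algebra $\mathcal O$ be as described in the context. Then $$\sigma(AX,\theta)=\sigma(A\theta,\mathcal O).$$
   Context: Setting. $(\Omega,\mathcal F,\mathbf P)$ is a probability space, $A=(a_{ij})$ is a $d\times n$ integer matrix, $\Theta:=\mathbb R_{\ge 0}^n$ with Borel $\sigma$-algebra $\mathcal B(\Theta)$. The parameter is treated as a random variable: $\theta:\Omega\to\Theta$ is measurable, and $X=(X_1,\dots,X_n)^\top:\Omega\to\mathbb Z_{\ge 0}^n$ is a random vector such that, conditionally on $\theta=c$, the $X_k$ are mutually independent with $X_k\sim\mathrm{Pois}(c_k)$ ($\mathrm{Pois}(0)$ is the point mass at $0$). It is assumed that $AX$ takes values in $\mathbb Z_{\ge 0}^d$. $A\theta$ is the $\mathbb R^d$-valued random vector $\omega\mapsto A\,\theta(\omega)$. Group action. $G:=\mathbb R_{>0}^d$ acts on $\Theta$ by $g\cdot c=\bigl(c_j\prod_{i=1}^d g_i^{a_{ij}}\bigr)_{j=1,\dots,n}$ and on $\mathbb Z_{\ge 0}^d\times\Theta$ by $g\cdot(b,c)=(b,g\cdot c)$; $G\cdot B:=\{g\cdot x\mid g\in G,\ x\in B\}$. The $\sigma$-algebra $\mathcal O$ is $$\mathcal O:=\bigl\{\{(AX,\theta)\in B\}\ \big|\ B\in\mathcal B(\mathbb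 Z_{\ge 0}^d)\times\mathcal B(\Theta),\ G\cdot B=B\bigr\},$$ where $\mathcal B(\mathbb Z_{\ge 0}^d)\times\mathcal B(\Theta)$ is the product $\sigma$-algebra. $\sigma(A\theta,\mathcal O)$ is the smallest $\sigma$-algebra on $\Omega$ containing $\mathcal O$ and making $A\theta$ measurable. *)

(* Defs.v *)
From HB Require Import structures.
From mathcomp Require Import all_boot all_order all_algebra.
From mathcomp Require Import all_classical all_reals all_analysis.
Set Implicit Arguments.
Unset Strict Implicit.
Unset Printing Implicit Defensive.
Import Order.TTheory GRing.Theory Num.Theory.
Import numFieldTopology.Exports.
Local Open Scope classical_set_scope.
Local Open Scope ring_scope.

Notation borel T := (g_sigma_algebraType (@open T)).

(* The parameter space, with the topology induced by 'cV[R]_n (the canonical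
   topology of a set_type). *)
Definition Theta (R : realType) (n : nat) : Type :=
  set_type [set c : 'cV[R]_n | forall j, 0 <= c j 0].

Lemma Theta0 (R : realType) (n : nat) :
  (0 : 'cV[R]_n) \in [set c : 'cV[R]_n | forall j, 0 <= c j 0].
Proof. by apply/mem_set => j; rewrite mxE. Qed.

HB.instance Definition _ (R : realType) (n : nat) :=
  Topological.copy (Theta R n)
    (set_type [set c : 'cV[R]_n | forall j, 0 <= c j 0]).
HB.instance Definition _ (R : realType) (n : nat) :=
  isPointed.Build (Theta R n) (SigSub (Theta0 R n)).

Definition posvec (R : realType) (d : nat) : Type :=
  set_type [set g : 'cV[R]_d | forall i, 0 < g i 0].

Section Action.
Context {R : realType} {d n : nat} (A : 'M[int]_(d, n)).

Definition act_col (g : 'cV[R]_d) (c : 'cV[R]_n) : 'cV[R]_n :=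
  \col_j (c j 0 * \prod_(i < d) g i 0 ^ A i j).

Lemma act_col_ge0 (g : posvec R d) (c : Theta R n) :
  act_col (set_val g) (set_val c) \in
    [set c : 'cV[R]_n | forall j, 0 <= c j 0].
Proof.
apply/mem_set => j; rewrite mxE mulr_ge0 //; first exact: (set_mem (valP c)).
by apply: prodr_ge0 => i _; apply/exprz_ge0/ltW; exact: (set_mem (valP g)).
Qed.

Definition act (g : posvec R d) (c : Theta R n) : Theta R n :=
  SigSub (act_col_ge0 g c).

Definition act_pair (g : posvec R d) (x : 'cV[nat]_d * Theta R n) :
    'cV[nat]_d * Theta R n :=
  (x.1, act g x.2).

Definition orbit_of (B : set ('cV[nat]_d * Theta R n)) :
    set ('cV[nat]_d * Theta R n) :=
  [set act_pair g x | g in [set: posvec R d] & x in B].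

End Action.

Definition mutually_independent dT (T : measurableType dT) (R : realType)
    (mu : {measure set T -> \bar R}) n (Y : 'I_n -> T -> nat) : Prop :=
  forall (J : {set 'I_n}) (E : 'I_n -> set nat),
    mu (\bigcap_(k in [set k | k \in J]) Y k @^-1` E k) =
    (\prod_(k in J) mu (Y k @^-1` E k))%E.

(* K is a regular conditional distribution of X given theta. *)
Definition conditional_law dO (Omega : measurableType dO) (R : realType)
    (P : probability Omega R) dS dT (S : measurableType dS)
    (T : measurableType dT) (X : {RV P >-> T}) (theta : {RV P >-> S})
    (K : R.-pker S ~> T) : Prop :=
  forall (B : set S) (E : set T), measurable B -> measurable E ->
    P (theta @^-1` B `&` X @^-1` E) =
    (\int[P]_(w in theta @^-1` B) K (theta w) E)%E.

(* poisson_prob r 0 is the law Pois(r), the point mass at 0 if r = 0; the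
   second argument of poisson_prob is a dummy. *)
Definition cond_independent_poisson dO (Omega : measurableType dO)
    (R : realType) (P : probability Omega R) n
    (X : {RV P >-> borel 'cV[nat]_n}) (theta : {RV P >-> borel (Theta R n)}) :
    Prop :=
  exists K : R.-pker borel (Theta R n) ~> borel 'cV[nat]_n,
    conditional_law X theta K /\
    forall c : Theta R n,
      mutually_independent (K c) (fun k (x : borel 'cV[nat]_n) => x k 0) /\
      forall (k : 'I_n) (E : set nat),
        K c [set x | E (x k 0)] = poisson_prob (set_val c k 0) 0 E.

Section SigmaAlgebras.
Context {R : realType} {d n : nat} {dO : measure_display}
  {Omega : measurableType dO}.
Variables (A : 'M[int]_(d, n)) (X : Omega -> 'cV[nat]_n)
  (theta : Omega -> Theta R n).

Definition AXZ (w : Omega) : 'cV[int]_d := A *m map_mx Posz (X w).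

(* AXZ as a vector of naturals; absz only changes the type when AXZ is
   nonnegative. *)
Definition AX (w : Omega) : 'cV[nat]_d := map_mx absz (AXZ w).

Definition Atheta (w : Omega) : 'cV[R]_d :=
  map_mx intr A *m set_val (theta w).

Definition AXtheta (w : Omega) : borel 'cV[nat]_d * borel (Theta R n) :=
  (AX w, theta w).

Definition sigma_O : set_system Omega :=
  [set AXtheta @^-1` B | B in
    [set B : set (borel 'cV[nat]_d * borel (Theta R n)) |
      measurable B /\ orbit_of A B = B]].

Definition sigma_Atheta_O : set_system Omega :=
  <<s g_sigma_algebra_preimage (Atheta : Omega -> borel 'cV[R]_d)
      `|` sigma_O >>.

End SigmaAlgebras.

(* Main.v *)
(* Theta is cut into finitely many strata according to the support S of the
   parameter. On a stratum, taking logarithms turns the action of G into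
   translation by the row space of A_S (the columns of A in S), so the logarithm
   modulo that row space is a G-invariant of c; together with A c it determines c,
   by Birch's theorem. The stratum is sigma-compact and this map is continuous on
   it, so it sends closed subsets of compact pieces to compact sets; hence every
   closed set of parameters is recovered from A theta and from invariant Borel
   sets. Adding the invariant sets {b} x Theta
   gives A X. *)
Require Import Defs.
From HB Require Import structures.
From mathcomp Require Import all_boot all_order all_algebra.
From mathcomp Require Import all_classical all_reals all_analysis.
Set Implicit Arguments.
Unset Strict Implicit.
Unset Printing Implicit Defensive.
Import Order.TTheory GRing.Theory Num.Theory.
Import numFieldTopology.Exports.
Local Open Scope classical_set_scope.
Local Open Scope ring_scope.
Import numFieldNormedType.Exports.

(** * Logarithmic invariants of the torus action and Birch uniqueness *)

Section LogInvariant.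
Context {R : realType} {d n : nat} (A : 'M[int]_(d, n)).
Implicit Types (S : {set 'I_n}) (c : 'cV[R]_n) (g : 'cV[R]_d).

(** Coordinates outside [S] are masked, so that the map stays continuous where they are merely close
    to 0. *)
Definition log_row S c : 'rV[R]_n := \row_j (if j \in S then ln (c j 0) else 0).

Definition restrict_cols S : 'M[R]_(d, n) :=
  \matrix_(i, j) (if j \in S then (A i j)%:~R else 0).

(** Right multiplication by [cokermx] kills exactly the row space, so this represents the class of
    the logarithm in the quotient by that space. *)
Definition orbit_inv S c : 'rV[R]_n := log_row S c *m cokermx (restrict_cols S).

Definition stratum S : set 'cV[R]_n :=
  [set c | forall j, if j \in S then is_true (0 < c j 0) else c j 0 = 0].

Lemma ln_exprz (x : R) (z : int) : 0 < x -> ln (x ^ z) = ln x *~ z.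
Proof.
move=> x0; case: z => k; first by rewrite -exprnP lnXn// pmulrn.
by rewrite NegzE -exprnN mulrNz lnV ?posrE ?exprn_gt0// lnXn// -pmulrn.
Qed.

Lemma ln_prod (I : finType) (F : I -> R) : (forall i, 0 < F i) ->
  ln (\prod_i F i) = \sum_i ln (F i).
Proof.
move=> F0; suff [] : ln (\prod_i F i) = \sum_i ln (F i) /\ 0 < \prod_i F i by [].
apply: (big_ind2 (fun x y => ln x = y /\ 0 < x)); rewrite ?ln1 ?ltr01//.
by move=> x1 y1 x2 y2 [<- x10] [<- x20]; rewrite lnM ?posrE// mulr_gt0.
Qed.

Lemma monomial_gt0 g (j : 'I_n) : (forall i, 0 < g i 0) ->
  0 < \prod_(i < d) g i 0 ^ A i j.
Proof. by move=> g0; apply: prodr_gt0 => i _; exact: exprz_gt0. Qed.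

Lemma log_row_act S g c : (forall i, 0 < g i 0) ->
  (forall j, j \in S -> 0 < c j 0) ->
  log_row S (act_col A g c) =
  log_row S c + (\row_i ln (g i 0)) *m restrict_cols S.
Proof.
move=> g0 c0; apply/rowP => j; rewrite !mxE.
case: ifPn => jS; last first.
  by rewrite big1 ?addr0// => i _; rewrite !mxE (negbTE jS) mulr0.
rewrite lnM ?posrE ?c0 ?monomial_gt0// ln_prod => [|i]; last exact: exprz_gt0.
by congr (_ + _); apply: eq_bigr => i _; rewrite !mxE jS ln_exprz// mulrzr.
Qed.

Lemma orbit_inv_act S g c : (forall i, 0 < g i 0) ->
  (forall j, j \in S -> 0 < c j 0) ->
  orbit_inv S (act_col A g c) = orbit_inv S c.
Proof.
by move=> g0 c0; rewrite /orbit_inv log_row_act// mulmxDl -mulmxA mulmx_coker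
  mulmx0 addr0.
Qed.

Lemma stratum_act S g c : (forall i, 0 < g i 0) ->
  stratum S c -> stratum S (act_col A g c).
Proof.
move=> g0 cS j; have := cS j; rewrite mxE; case: ifP => _.
  by move=> c0; rewrite mulr_gt0 ?monomial_gt0.
by move=> ->; rewrite mul0r.
Qed.

(** Since [ln] is increasing, both factors have the same sign. *)
Lemma mulr_ln_diff_ge0 (x y : R) : 0 < x -> 0 < y ->
  0 <= (x - y) * (ln x - ln y).
Proof.
move=> x0 y0; have [xy|yx] := leP x y.
  by rewrite mulr_le0// subr_le0// ler_ln.
by rewrite mulr_ge0// subr_ge0 ?ler_ln// ltW.
Qed.

(* Birch's theorem: for y with ln c - ln c' = y A on S, the sum of the terms
   (c_j - c'_j) (ln c_j - ln c'_j) >= 0 over S is y A (c - c') = 0. *)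
Lemma stratum_inj S c c' : stratum S c -> stratum S c' ->
  map_mx intr A *m c = map_mx intr A *m c' -> orbit_inv S c = orbit_inv S c' ->
  c = c'.
Proof.
move=> cS cS' eA /eqP; rewrite -subr_eq0 -mulmxBl -submxE => /submxP[y yE].
have eq_sum : \sum_j (c - c') j 0 * (log_row S c - log_row S c') 0 j = 0.
  transitivity ((y *m (map_mx intr A *m (c - c'))) 0 0); last first.
    by rewrite mulmxBr eA subrr mulmx0 mxE.
  rewrite mulmxA mxE; apply: eq_bigr => j _; rewrite yE !mxE mulrC.
  have [jS|jS] := boolP (j \in S).
    by congr (_ * _); apply: eq_bigr => i _; rewrite !mxE jS.
  have := cS j; have := cS' j; rewrite (negbTE jS) => -> ->.
  by rewrite subrr !mulr0.
have term_ge0 j :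
    0 <= (c - c') j 0 * (log_row S c - log_row S c') 0 j.
  rewrite !mxE; have := cS j; have := cS' j; case: ifP => _ ? ?.
    exact: mulr_ln_diff_ge0.
  by rewrite subrr mulr0.
have term_eq0 := psumr_eq0P (fun j _ => term_ge0 j) eq_sum.
apply/colP => j; have /eqP := term_eq0 j isT.
rewrite !mxE; have := cS j; have := cS' j; case: ifP => _ c'0 c0; last first.
  by rewrite c0 c'0.
rewrite mulf_eq0 !subr_eq0 => /orP[/eqP//|/eqP].
by apply: ln_inj; rewrite posrE.
Qed.

End LogInvariant.

(** * Matrix convergence, compactness and countable dense sets *)

Section Topology.

Lemma cvg_mx (T : Type) (F : set_system T) {FF : Filter F} (U : topologicalType)
    m n (f : T -> 'M[U]_(m, n)) (M : 'M[U]_(m, n)) :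
  (forall i j, f x i j @[x --> F] --> M i j) -> f @ F --> M.
Proof.
move=> fM B [P MP PB].
have : \forall x \near F, forall i j, P i j (f x i j).
  by apply: filter_forall => i; apply: filter_forall => j; exact/fM/MP.
by apply: filterS => x fxP; exact: PB.
Qed.

Lemma cvg_mulmx (K : numFieldType) (T : Type) (F : set_system T)
    {FF : Filter F} m n p (f : T -> 'M[K]_(m, n)) (g : T -> 'M[K]_(n, p))
    (M : 'M[K]_(m, n)) (N : 'M[K]_(n, p)) :
  f @ F --> M -> g @ F --> N -> f x *m g x @[x --> F] --> M *m N.
Proof.
move=> fM gN; apply: cvg_mx => i k; rewrite mxE; under eq_fun do rewrite mxE.
apply: cvg_big => [|j _]; [exact: add_continuous|apply: cvgM].
  exact: (cvg_comp _ _ fM (@coord_continuous _ _ _ i j M)).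
exact: (cvg_comp _ _ gN (@coord_continuous _ _ _ j k N)).
Qed.

Lemma cV_compact (T : ptopologicalType) n (B : 'I_n -> set T) :
  (forall i, compact (B i)) ->
  compact [set v : 'cV[T]_n | forall i, B i (v i 0)].
Proof.
move=> cB.
have -> : [set v : 'cV[T]_n | forall i, B i (v i 0)] =
    trmx @` [set v : 'rV[T]_n | forall i, B i (v ord0 i)].
  apply/seteqP; split => [v vB|_ [v vB <-] i]; last by rewrite mxE.
  by exists v^T; [move=> i; rewrite mxE; exact: vB|exact: trmxK].
apply: continuous_compact; last exact: rV_compact.
apply: continuous_subspaceT => v B' [P vP PB]; exists (fun i j => P j i).
  by move=> i j; have := vP j i; rewrite mxE.
by move=> w wP; apply: PB => i j; rewrite mxE; exact: wP.
Qed.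

(* With q enumerating a countable set of centres, this writes F as a countable
   Boolean combination of balls. *)
Lemma closed_dense_ballP (R : realType) (M : pseudoMetricType R) (D : Type)
    (q : D -> M) (F : set M) :
  (forall y (e : R), 0 < e -> exists p, ball (q p) e y) -> closed F ->
  forall y, F y <-> forall k, exists2 p,
    ball (q p) (k.+1%:R^-1 : R) `&` F !=set0 & ball (q p) (k.+1%:R^-1 : R) y.
Proof.
move=> dq cF y; split => [Fy k|yF].
  by have [|p ypk] := dq y k.+1%:R^-1; [rewrite invr_gt0|exists p => //; exists y].
apply: cF => B /nbhs_ballP[e /= e0 yB].
have e20 : 0 < e / 2 by rewrite divr_gt0.
have [k _ /(_ _ (leqnn _)) ke] := near_infty_natSinv_lt (PosNum e20).
have [p [z [pz Fz]] py] := yF k.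
exists z; split => //; apply: yB; apply: (@ball_splitr _ _ (q p)).
  exact: le_ball (ltW ke) _ py.
exact: le_ball (ltW ke) _ pz.
Qed.

(** Supplies the countable set of centres for [closed_dense_ballP]. *)
Lemma rat_mx_dense (R : realType) m n (M : 'M[R]_(m, n)) (e : R) : 0 < e ->
  exists p : 'M[rat]_(m, n), ball (map_mx ratr p : 'M[R]_(m, n)) e M.
Proof.
move=> e0.
have ratM i j : exists q : rat, ball (ratr q : R) e (M i j).
  have [|q] := @rat_in_itvoo R (M i j - e) (M i j + e).
    by rewrite ltrD2l gtrN.
  rewrite in_itv /= => qM; exists q.
  by rewrite /ball /= ltr_distl.
exists (\matrix_(i, j) sval (cid (ratM i j))); split => // i j.
by rewrite !mxE; exact: (svalP (cid (ratM i j))).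
Qed.

End Topology.

(** * Compact exhaustion of the strata and continuity of the Birch map *)

Section Strata.
Context {R : realType} {d n : nat} (A : 'M[int]_(d, n)).
Implicit Types (S : {set 'I_n}) (c : 'cV[R]_n).

(** An open set containing the stratum: leaving the coordinates outside [S] free makes it possible
    to state continuity at a point of the ambient space. *)
Definition positive_on S : set 'cV[R]_n :=
  [set c | forall j, j \in S -> 0 < c j 0].

(** The bounds keep the coordinates in [S] away from 0 and from infinity; as [k] grows, the boxes
    exhaust the stratum. *)
Definition box S (k : nat) : set 'cV[R]_n :=
  [set c | forall j,
    (if j \in S then `[k.+1%:R^-1, k.+1%:R]%classic else [set 0]) (c j 0)].

(** Injective on the stratum by [stratum_inj]; the first component is seen by A theta, the second by
    the invariant sets. *)
Definition birch_map S c : 'cV[R]_d * 'rV[R]_n :=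
  (map_mx intr A *m c, orbit_inv A S c).

Lemma stratum_positive_on S : stratum S `<=` positive_on S.
Proof. by move=> c cS j jS; have := cS j; rewrite jS. Qed.

Lemma box_stratum S k : box S k `<=` stratum S.
Proof.
move=> c cS j; have := cS j; case: ifP => // _ /=.
by rewrite in_itv /= => /andP[+ _]; apply: lt_le_trans; rewrite invr_gt0.
Qed.

Lemma box_compact S k : compact (box S k).
Proof.
apply: (@cV_compact R n
  (fun j => if j \in S then `[k.+1%:R^-1, k.+1%:R]%classic else [set 0])) => j.
case: ifP => _; first exact: segment_compact.
exact: compact_set1.
Qed.

Lemma stratum_bigcup_box S : stratum S = \bigcup_k box S k.
Proof.
apply/seteqP; split => [c cS|c [k _ ck]]; last exact: box_stratum ck.
suff : \forall k \near \oo, box S k c by move=> [N _ /(_ _ (leqnn N))]; exists N.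
apply: filter_forall => j; have := cS j; case: ifP => _ cj0; last exact: nearW.
near=> k; rewrite /= in_itv; apply/andP; split.
  by apply/ltW; near: k; exact: (near_infty_natSinv_lt (PosNum cj0)).
apply: (@le_trans _ _ k%:R); last by rewrite ler_nat.
by near: k; exact: nbhs_infty_ger.
Unshelve. all: by end_near. Qed.

Lemma nonneg_stratum c : (forall j, 0 <= c j 0) ->
  exists S, stratum S c.
Proof.
move=> c0; exists [set j | 0 < c j 0]%SET => j; rewrite inE; case: ifPn => //.
by rewrite -leNgt => cj; apply/eqP; rewrite eq_le cj c0.
Qed.

Lemma open_positive_on S : open (positive_on S).
Proof.
rewrite openE => c c0.
suff : nbhs c (fun x : 'cV[R]_n => forall j, j \in S -> 0 < x j 0) by [].
apply: (@filter_forall _ _ _ _ (nbhs_filter c)) => j.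
have [jS|_] := boolP (j \in S); last exact: nearW.
have /(@coord_continuous _ _ _ j 0 c) : nbhs (c j 0) [set y | 0 < y].
  exact: (lt_nbhsr (c0 j jS)).
by apply: (@filterS _ _ (nbhs_filter c)) => y y0 _.
Qed.

Lemma cvg_log_row S c : positive_on S c ->
  log_row S x @[x --> c] --> log_row S c.
Proof.
move=> c0; apply: (@cvg_mx _ (nbhs c) (nbhs_filter c)) => i j.
rewrite mxE; under eq_fun do rewrite mxE.
case: ifP => jS; last exact: cvg_cst.
exact: (cvg_comp _ _ (@coord_continuous _ _ _ j 0 c) (continuous_ln (c0 j jS))).
Qed.

Lemma cvg_orbit_inv S c : positive_on S c ->
  orbit_inv A S x @[x --> c] --> orbit_inv A S c.
Proof.
move=> c0; apply: (@cvg_mulmx _ _ (nbhs c) (nbhs_filter c)).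
  exact: cvg_log_row.
exact: cvg_cst.
Qed.

Lemma cvg_birch_map S c : positive_on S c ->
  birch_map S x @[x --> c] --> birch_map S c.
Proof.
move=> c0.
apply: (@cvg_pair _ _ _ (nbhs c) (nbhs (map_mx intr A *m c : 'cV[R]_d))
  (nbhs (orbit_inv A S c)) (nbhs_filter c)); last exact: cvg_orbit_inv.
apply: (@cvg_mulmx _ _ (nbhs c) (nbhs_filter c)); [exact: cvg_cst|exact: cvg_id].
Qed.

(* The image is compact because the boxes lie away from the faces c_j = 0,
   where the logarithms are discontinuous. *)
Lemma closed_birch_map_box S k (V : set 'cV[R]_n) : open V ->
  closed (birch_map S @` (~` V `&` box S k)).
Proof.
move=> oV; apply: compact_closed; first exact: norm_hausdorff.
apply: continuous_compact.
  apply: continuous_in_subspaceT => c /set_mem[_ /box_stratum].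
  by move/stratum_positive_on; exact: cvg_birch_map.
by rewrite setIC; apply: compact_closedI; [exact: box_compact|exact: open_closedC].
Qed.

End Strata.

(** * Recovering A X and theta from A theta and the invariant sets *)

Lemma measurable_countable_bigcup d (T : sigmaRingType d) (D : countType)
    (P : set D) (F : D -> set T) :
  (forall p, measurable (F p)) -> measurable (\bigcup_(p in P) F p).
Proof.
move=> mF; rewrite bigcup_mkcond; apply: countable_bigcupT_measurable => // p.
by case: ifP.
Qed.

Section Measurability.
Context {R : realType} {d n : nat} (A : 'M[int]_(d, n)).
Implicit Types (S : {set 'I_n}).

Lemma theta_ge0 (c : Theta R n) (j : 'I_n) : 0 <= set_val c j 0.
Proof. exact: (set_mem (valP c)). Qed.

Lemma open_set_val (V : set 'cV[R]_n) : open V ->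
  open (set_val @^-1` V : set (Theta R n)).
Proof. by move=> oV; exists V. Qed.

(** Openness is asked of the trace on [positive_on S], where [orbit_inv] is known to be
    continuous. *)
Lemma measurable_stratum_setI S (V : set 'cV[R]_n) :
  open (positive_on S `&` V) ->
  measurable (set_val @^-1` (stratum S `&` V) : set (borel (Theta R n))).
Proof.
move=> oV.
(* A difference of two open sets: in [Theta], a coordinate that is not positive is 0. *)
have -> : set_val @^-1` (stratum S `&` V) =
    (set_val @^-1` (positive_on S `&` V) : set (Theta R n)) `\`
      \bigcup_(j in [set j | j \notin S]) set_val @^-1` (positive_on [set j]).
  apply/seteqP; split => [c [cS Vc]|c [[cS Vc] cN]]; split => //.
  - by split=> //; exact: stratum_positive_on cS.
  - move=> [j /= jS /(_ j)]; rewrite inE eqxx => /(_ isT).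
    by have := cS j; rewrite (negbTE jS) => ->; rewrite ltxx.
  - move=> j; case: ifPn => [/cS//|jS]; apply/eqP; rewrite eq_le theta_ge0 andbT.
    rewrite leNgt; apply/negP => cj; apply: cN; exists j => // i.
    by rewrite inE => /eqP ->.
apply: measurableD; apply: sub_sigma_algebra; first exact: open_set_val.
by apply: bigcup_open => j _; exact/open_set_val/open_positive_on.
Qed.

Lemma measurable_stratum_orbit_inv S (V : set 'rV[R]_n) : open V ->
  measurable (set_val @^-1` (stratum S `&` orbit_inv A S @^-1` V)
    : set (borel (Theta R n))).
Proof.
move=> oV; apply: measurable_stratum_setI; rewrite openE => c [c0 Vc].
apply: (@filterI _ (nbhs c) (nbhs_filter c)).
  exact: (open_nbhs_nbhs (conj (@open_positive_on R n S) c0)).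
exact: (cvg_orbit_inv c0 (open_nbhs_nbhs (conj oV Vc))).
Qed.

Lemma one_posvec :
  (const_mx 1 : 'cV[R]_d) \in [set g : 'cV[R]_d | forall i, 0 < g i 0].
Proof. by apply/mem_set => i; rewrite mxE. Qed.

Lemma act1 (c : Theta R n) : act A (SigSub one_posvec) c = c.
Proof.
apply: val_inj; apply/colP => j; rewrite mxE big1 ?mulr1// => i _.
by rewrite mxE exp1rz.
Qed.

Lemma orbit_of_invariant (B : set ('cV[nat]_d * Theta R n)) :
  (forall g x, B x -> B (act_pair A g x)) -> orbit_of A B = B.
Proof.
move=> Binv; apply/seteqP; split => [_ [g _ [x Bx <-]]|[b c] Bbc].
  exact: Binv.
(* The unit of G shows that every set lies in its orbit. *)
exists (SigSub one_posvec) => //; exists (b, c) => //.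
by rewrite /act_pair act1.
Qed.

Context {dO : measure_display} {Omega : measurableType dO}.
Variables (X : Omega -> 'cV[nat]_n) (theta : Omega -> Theta R n).
Local Notation generators :=
  (g_sigma_algebra_preimage (Atheta A theta : Omega -> borel 'cV[R]_d)
     `|` sigma_O A X theta).
(** Omega with the sigma-algebra generated by A theta and O; measurability in [M] is membership in
    it. *)
Local Notation M := (g_sigma_algebraType generators).

Lemma measurable_Atheta_preimage (V : set 'cV[R]_d) : open V ->
  measurable (Atheta A theta @^-1` V : set M).
Proof.
move=> oV; apply: sub_sigma_algebra; left; exists V; last by rewrite setTI.
exact: sub_sigma_algebra.
Qed.

Lemma measurable_invariant_preimage
    (B : set (borel 'cV[nat]_d * borel (Theta R n))) :
  measurable B -> (forall g x, B x -> B (act_pair A g x)) ->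
  measurable (AXtheta A X theta @^-1` B : set M).
Proof.
move=> mB Binv; apply: sub_sigma_algebra; right; exists B => //.
by split => //; exact: orbit_of_invariant.
Qed.

Lemma measurable_orbit_inv_preimage S (V : set 'rV[R]_n) : open V ->
  measurable (theta @^-1` (set_val @^-1`
    (stratum S `&` orbit_inv A S @^-1` V)) : set M).
Proof.
move=> oV.
pose C : set (borel (Theta R n)) :=
  set_val @^-1` (stratum S `&` orbit_inv A S @^-1` V).
(* Leaving A X free turns the invariant set [C] of parameters into an invariant set of pairs. *)
have -> : theta @^-1` C = AXtheta A X theta @^-1` (setT `*` C).
  by apply/seteqP; split => [w Cw|w []].
apply: measurable_invariant_preimage.
  by apply: measurableX => //; exact: measurable_stratum_orbit_inv.
move=> g [b c] [_ [cS Vc]]; split => //; split.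
  by apply: stratum_act => // i; exact: (set_mem (valP g)).
rewrite /= orbit_inv_act// => [i|]; first exact: (set_mem (valP g)).
exact: stratum_positive_on.
Qed.

(** By injectivity, theta lies in the piece iff it lies in the stratum and its Birch image lies in
    the closed set [F]. Balls describe [F] countably, and each is a product of a condition on A
    theta and one on the invariant. *)
Lemma measurable_closed_box_preimage S k (V : set 'cV[R]_n) : open V ->
  measurable (theta @^-1` (set_val @^-1` (~` V `&` box S k)) : set M).
Proof.
move=> oV.
pose q (p : 'cV[rat]_d * 'rV[rat]_n) : 'cV[R]_d * 'rV[R]_n :=
  (map_mx ratr p.1, map_mx ratr p.2).
pose F := birch_map A S @` (~` V `&` box S k).
have dq (y : 'cV[R]_d * 'rV[R]_n) (e : R) : 0 < e -> exists p, ball (q p) e y.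
  move=> e0; have [p1 y1] := rat_mx_dense y.1 e0.
  by have [p2 y2] := rat_mx_dense y.2 e0; exists (p1, p2).
have FP := closed_dense_ballP dq
  (closed_birch_map_box (A := A) (S := S) (k := k) oV).
have -> : theta @^-1` (set_val @^-1` (~` V `&` box S k)) =
    \bigcap_i \bigcup_(p in [set p | ball (q p) (i.+1%:R^-1 : R) `&` F !=set0])
      (Atheta A theta @^-1` ball (q p).1 (i.+1%:R^-1 : R) `&`
       theta @^-1` (set_val @^-1` (stratum S `&`
         orbit_inv A S @^-1` ball (q p).2 (i.+1%:R^-1 : R)))).
  apply/seteqP; split => [w [wV wbox] i _|w wU].
    have : F (birch_map A S (set_val (theta w))) by exists (set_val (theta w)).
    move=> /FP/(_ i)[p pF [p1 p2]]; exists p => //; split => //.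
    by split => //; exact: box_stratum wbox.
  have wS : stratum S (set_val (theta w)) by have [p _ [_ []]] := wU 0%N I.
  have : F (birch_map A S (set_val (theta w))).
    by apply/FP => i; have [p pF [p1 [_ p2]]] := wU i I; exists p.
  (* The point [c] of the piece has the same Birch image as theta, hence equals it. *)
  move=> [c cK [eA eI]]; have cS : stratum S c by case: cK => _ /box_stratum.
  by rewrite /= -(stratum_inj cS wS eA eI).
apply: bigcapT_measurable => i; apply: measurable_countable_bigcup => p.
apply: measurableI.
  by apply: measurable_Atheta_preimage; exact: ball_open.
by apply: measurable_orbit_inv_preimage; exact: ball_open.
Qed.

Lemma measurable_theta : measurable_fun setT (theta : M -> borel (Theta R n)).
Proof.
apply: (@measurability _ _ M (borel (Theta R n)) setT theta open erefl).
move=> _ [_ [V oV <-] <-]; rewrite setTI.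
rewrite -[_ @^-1` _]setCK; apply: measurableC.
(* The closed complement is cut along the finitely many supports and, for each, countably many
   boxes. *)
have -> : ~` (theta @^-1` (set_val @^-1` V)) =
    \bigcup_(S in [set: {set 'I_n}]) \bigcup_k
      (theta @^-1` (set_val @^-1` (~` V `&` box S k))).
  apply/seteqP; split => [w wV|w [S _ [k _ []]]]; last by [].
  have [S] := nonneg_stratum (theta_ge0 (theta w)).
  by rewrite stratum_bigcup_box => -[k _ wk]; exists S => //; exists k.
apply: measurable_countable_bigcup => S; apply: bigcupT_measurable => k.
exact: measurable_closed_box_preimage.
Qed.

Lemma measurable_AX : measurable_fun setT (AX A X : M -> borel 'cV[nat]_d).
Proof.
move=> _ B mB; rewrite setTI.
(* G fixes the first component, so this product is invariant. *)
have -> : AX A X @^-1` B = AXtheta A X theta @^-1` (B `*` setT).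
  by apply/seteqP; split => [w Bw|w []].
by apply: measurable_invariant_preimage => [|g [b c] []//]; exact: measurableX.
Qed.

Lemma measurable_AXtheta : measurable_fun setT
  (AXtheta A X theta : M -> borel 'cV[nat]_d * borel (Theta R n)).
Proof. exact: measurable_fun_pair measurable_AX measurable_theta. Qed.

Lemma measurable_mulmx_theta (B : 'M[R]_(d, n)) :
  measurable_fun setT (fun c : borel (Theta R n) => B *m set_val c : borel 'cV[R]_d).
Proof.
apply: (@measurability _ _ (borel (Theta R n)) (borel 'cV[R]_d) setT _ open erefl).
move=> _ [V oV <-]; rewrite setTI.
apply: sub_sigma_algebra.
apply: (@open_set_val (mulmx B @^-1` V)); apply: open_comp => // c _.
apply: (@cvg_mulmx _ _ (nbhs c) (nbhs_filter c)); [exact: cvg_cst|exact: cvg_id].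
Qed.

End Measurability.

Theorem theorem5 (R : realType) (d n : nat) (dO : measure_display)
    (Omega : measurableType dO) (P : probability Omega R)
    (A : 'M[int]_(d, n))
    (theta : {RV P >-> borel (Theta R n)})
    (X : {RV P >-> borel 'cV[nat]_n})
    (X_cond : cond_independent_poisson X theta)
    (AX_ge0 : forall (w : Omega) (i : 'I_d), 0 <= AXZ A X w i 0) :
  g_sigma_algebra_preimage (AXtheta A X theta) = sigma_Atheta_O A X theta.
Proof.
apply/seteqP; split => [_ [B mB <-]|].
  exact: (measurable_AXtheta measurableT mB).
(* Conversely, each generator is a preimage under (A X, theta): for O by definition, for A theta
   because A c is continuous in c. *)
apply: smallest_sub.
  by apply: sigma_algebra_preimage; exact: sigma_algebra_measurable.
move=> _ [[B mB <-]|[B [mB _] <-]]; last by exists B; rewrite ?setTI.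
pose C := (fun c : borel (Theta R n) =>
  map_mx intr A *m set_val c : borel 'cV[R]_d) @^-1` B.
exists (setT `*` C).
  apply: measurableX => //; rewrite /C -[_ @^-1` _]setTI.
  exact: (measurable_mulmx_theta _ measurableT mB).
by rewrite !setTI; apply/seteqP; split => [w []|].
Qed.
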